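(* Let $\lambda>0$ and consider the type II AWGN wiretap channel AWGN-WT($\lambda$) described in the context. Let $\{\mathcal{C}_1(n)\}$ be a good binary linear code sequence of rate $R_1$ whose SNR threshold for binary-input AWGN channels is $\lambda^{\star}$, and let $\mathcal{C}_0(n)=\{0,1\}^n$. Suppose the secure nested code sequence $\{\mathcal{C}_0(n),\mathcal{C}_1(n)\}$ is used over AWGN-WT($\lambda$). If $\lambda\ge\lambda^{\star}$, then the rate-equivocation pair $$(R,R_e)=\bigl(1-R_1,\;1-C_{\rm BI\text{-}AWGN}(\lambda)\bigr)$$ is achievable.
   Context: Type II AWGN wiretap channel AWGN-WT($\lambda$): the transmitter sends a binary sequence $\mathbf{x}\in\{0,1\}^n$ (symbols mapped to $\pm1$); the main channel to the legitimate receiver is noiseless ($\mathbf{y}=\mathbf{x}$); the eavesdropper channel is memoryless binary-input AWGN with output densities $g(z|X=1)=\frac{1}{\sqrt{2\pi}}\exp[-(z+\sqrt{2\lambda})^2/2]$ and $g(z|X=-1)=\frac{1}{\sqrt{2\pi}}\exp[-(z-\sqrt{2\lambda})^2/2]$; $\lambda$ is the eavesdropper SNR. Its capacity is $C_{\rm BI\text{-}AWGN}(\lambda)=1-\frac{1}{\sqrt{\pi}}\int_{-\infty}^{\infty}e^{-(y-\sqrt{\lambda})^2}\log_2(1+e^{-4y\sqrt{\lambda}})\,dy$. A binary linear code sequence $\{\mathcal{C}(n)\}$ consists of $(n,k_n)$ binary linear codes with common rate $R_c=k_n/n$. It is good if it achieves arbitrarily small word error probability over a noisy channel at nonzero rate.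 For a channel family described by a single parameter, the noise threshold of the sequence is the worst-case channel parameter value at which the word error probability (under maximum-likelihood decoding) tends to zero as $n\to\infty$; for BI-AWGN channels this is the SNR threshold $\lambda^\star$ (error probability tends to zero for every SNR $\ge\lambda^\star$). Secure nested code sequence: $\mathcal{C}_1(n)\subseteq\mathcal{C}_0(n)$ linear codes of rates $R_1\le R_0$; the cosets of $\mathcal{C}_1(n)$ in $\mathcal{C}_0(n)$ are indexed by messages $w\in\mathcal{W}=\{1,\dots,M\}$, $M=2^{n(R_0-R_1)}$; message $W$ (uniform) is encoded by choosing a codeword uniformly at random from coset $\mathcal{C}_w(n)$; the legitimate receiver recovers $w$ as the coset of the received word. Information rate is $R_0-R_1$. A pair $(R,R_e)$ is achievable if there is a rate-$R$ code sequence with average error probability at the legitimate receiver tending to $0$ as $n\to\infty$ and $R_e\le\lim_{n\to\infty}H(W|\mathbf{Z})/n$, where $\mathbf{Z}$ is the eavesdropper's output. *)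

(* Defs.v *)
From HB Require Import structures.
From mathcomp Require Import all_boot all_order all_algebra.
From mathcomp Require Import all_classical all_reals all_analysis.
Set Implicit Arguments. Unset Strict Implicit. Unset Printing Implicit Defensive.
Import Order.TTheory GRing.Theory Num.Theory.
Import numFieldNormedType.Exports.

Local Open Scope ring_scope.

Section WT.
Variable R : realType.

Definition log2 (x : R) : R := ln x / ln 2.

(* Binary-input AWGN channel with SNR s.  Bit 0 <-> X = +1, bit 1 <-> X = -1.
   g(z | X=1) = N(-sqrt(2s), 1), g(z | X=-1) = N(+sqrt(2s), 1). *)
Definition awgn_mean (s : R) (b : 'F_2) : R :=
  if b == 0 then - Num.sqrt (2 * s) else Num.sqrt (2 * s).

Definition awgn_g (s : R) (b : 'F_2) (z : R) : R :=
  (Num.sqrt (2 * pi))^-1 * expR (- (z - awgn_mean s b) ^+ 2 / 2).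

(* memoryless n-letter output density; z : nat -> R, only z 0 .. z (n-1) matter *)
Definition chan (n : nat) (s : R) (x : 'rV['F_2]_n) (z : nat -> R) : R :=
  \prod_(i < n) awgn_g s (x ord0 i) (z i).

Definition ncons (t : R) (z : nat -> R) : nat -> R :=
  fun i => if i is k.+1 then z k else t.

Fixpoint iint (n : nat) (f : (nat -> R) -> \bar R) : \bar R :=
  match n with
  | 0 => f (fun _ => 0)
  | k.+1 => (\int[@lebesgue_measure R]_t iint k (fun z => f (ncons t z)))%E
  end.

Definition C_biawgn (l : R) : R :=
  1 - (Num.sqrt pi)^-1 *
      fine (\int[@lebesgue_measure R]_y
              (expR (- (y - Num.sqrt l) ^+ 2) * log2 (1 + expR (- (4 * y * Num.sqrt l))))%:E)%E.

Definition code (k n : nat) (G : 'M['F_2]_(k, n)) : {set 'rV['F_2]_n} :=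
  [set x : 'rV['F_2]_n | (x <= G)%MS].

(* word error probability of ML decoding of code C over BI-AWGN(s), averaged
   over uniformly chosen codewords; ties counted as errors *)
Definition ml_err (n : nat) (C : {set 'rV['F_2]_n}) (s : R) : \bar R :=
  ((#|C|%:R)^-1)%:E *
  (\sum_(c in C) iint n (fun z =>
     (if [exists c' in C, (c' != c) && (chan s c z <= chan s c' z)]
      then chan s c z else 0)%:E))%E.

Definition ml_vanishes (N K : nat -> nat) (G : forall j, 'M['F_2]_(K j, N j)) (s : R) :=
  ((fun j => ml_err (code (G j)) s) @ \oo --> 0%E)%classic.

Definition is_snr_threshold (N K : nat -> nat) (G : forall j, 'M['F_2]_(K j, N j))
    (lstar : R) :=
  (forall s, lstar <= s -> ml_vanishes G s) /\
  (forall s, s < lstar -> exists s', s <= s' /\ ~ ml_vanishes G s').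

(* Secure nested code C1 (inner) inside C0 = {0,1}^n: messages are the cosets *)
Definition cosets (n : nat) (C : {set 'rV['F_2]_n}) : {set {set 'rV['F_2]_n}} :=
  [set [set x + c | c in C] | x : 'rV['F_2]_n].

Definition pW (n : nat) (C : {set 'rV['F_2]_n}) : R := (#|cosets C|%:R)^-1.

(* eavesdropper density given message (coset) w: uniform codeword of w sent *)
Definition pzw (n : nat) (s : R) (w : {set 'rV['F_2]_n}) (z : nat -> R) : R :=
  (#|w|%:R)^-1 * \sum_(x in w) chan s x z.

Definition pz (n : nat) (s : R) (C : {set 'rV['F_2]_n}) (z : nat -> R) : R :=
  \sum_(w in cosets C) pW C * pzw s w z.

Definition HWZ (n : nat) (s : R) (C : {set 'rV['F_2]_n}) : \bar R :=
  iint n (fun z => (\sum_(w in cosets C)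
     pW C * pzw s w z * log2 (pz s C z / (pW C * pzw s w z)))%:E).

(* legitimate receiver: noiseless channel y = x, decodes the coset of y *)
Definition legit_err (n : nat) (C : {set 'rV['F_2]_n}) : R :=
  \sum_(w in cosets C) pW C *
     ((#|w|%:R)^-1 * #|[set x in w | [set x + c | c in C] != w]|%:R).

End WT.

(* Main.v *)
Require Import Defs.
From HB Require Import structures.
From mathcomp Require Import all_boot all_order all_algebra.
From mathcomp Require Import all_classical all_reals all_analysis.
From mathcomp Require Import measurable_realfun ring.
Import Order.TTheory GRing.Theory Num.Theory.
Import numFieldNormedType.Exports.
Require Import Defs.

Set Implicit Arguments.
Unset Strict Implicit.
Unset Printing Implicit Defensive.

Local Open Scope ring_scope.

(** Let X be the transmitted word, W its coset and D = 1 - C(lambda). The chain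
    rule reads H(W | Z) + H(X | W, Z) = H(X | Z) = n D, the last equality because X
    is uniform on F_2^n and the channel is memoryless. Each of these entropies is an
    average over x of integrals that the sign change z_i -> - z_i (for x_i = 1)
    identifies, so x = 0 suffices. The same symmetry turns H(X | W, Z) into the
    equivocation of C_1 alone, which Fano's inequality bounds by a constant plus K
    times the ML error probability; divided by n this tends to 0, since lambda is
    above the threshold. *)

(** * Iterated Lebesgue integrals of nonnegative functions of a sequence *)

Section IteratedIntegral.
Variable R : realType.
Implicit Types (n : nat) (f g : (nat -> R) -> R).
Notation mu := (@lebesgue_measure R).

(* Measurability after composition with every measurable family of coordinates: this
   avoids putting a sigma-algebra on [nat -> R]. *)
Definition cyl_measurable d (T : measurableType d) (F : T -> (nat -> R) -> R) : Prop :=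
  forall d' (T' : measurableType d') (h : T' -> T) (z : T' -> nat -> R),
    measurable_fun setT h -> (forall i, measurable_fun setT (z ^~ i)) ->
    measurable_fun setT (fun t => F (h t) (z t)).

Definition seq_measurable f : Prop :=
  forall d (T : measurableType d) (z : T -> nat -> R),
    (forall i, measurable_fun setT (z ^~ i)) -> measurable_fun setT (fun t => f (z t)).

Lemma measurable_ncons d (T : measurableType d) (t : T -> R) (z : T -> nat -> R) :
  measurable_fun setT t -> (forall i, measurable_fun setT (z ^~ i)) ->
  forall i, measurable_fun setT (fun x => ncons (t x) (z x) i).
Proof. by move=> mt mz [|i] /=; [exact: mt|exact: mz]. Qed.

Lemma seq_measurable_ncons f (t : R) : seq_measurable f -> seq_measurable (fun z => f (ncons t z)).
Proof. by move=> mf d T z mz; apply: mf; exact: measurable_ncons. Qed.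

Lemma cyl_measurable_ncons f : seq_measurable f -> cyl_measurable (fun t z => f (ncons t z)).
Proof. by move=> mf d T h z mh mz; apply: mf; exact: measurable_ncons. Qed.

Lemma iint_ge0 n (f : (nat -> R) -> \bar R) : (forall z, 0 <= f z)%E -> (0 <= iint n f)%E.
Proof.
elim: n f => [|n IHn] f f0 //=; apply: integral_ge0 => t _; exact: IHn.
Qed.

(** Tonelli's theorem, with the parameter space generalised in the induction: the outermost variable
    joins the parameters before the induction hypothesis is applied. *)
Lemma measurable_iint n d (T : measurableType d) (F : T -> (nat -> R) -> R) :
  cyl_measurable F -> (forall x z, 0 <= F x z) ->
  measurable_fun setT (fun x => iint n (fun z => (F x z)%:E)).
Proof.
elim: n d T F => [|n IHn] d T F mF F0 /=.
  by apply/measurable_EFinP; apply: (mF _ _ id).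
pose Fp (p : T * measurableTypeR R) (z : nat -> R) := F p.1 (ncons p.2 z).
have mFp : cyl_measurable Fp.
  move=> d' T' h z mh mz; apply: mF; first exact: measurableT_comp.
  by apply: measurable_ncons => //; exact: measurableT_comp.
have mp := IHn _ _ Fp mFp (fun _ _ => F0 _ _).
apply: (@measurable_fun_fubini_tonelli_F _ _ _ _ _ mu _ mp) => p.
by apply: iint_ge0 => z; rewrite lee_fin F0.
Qed.

Lemma measurable_iint_ncons n f : seq_measurable f -> (forall z, 0 <= f z) ->
  measurable_fun setT (fun t : R => iint n (fun z => (f (ncons t z))%:E)).
Proof.
move=> mf f0; apply: (@measurable_iint n _ R (fun t z => f (ncons t z))) => //.
exact: cyl_measurable_ncons.
Qed.

Lemma iintD n f g : seq_measurable f -> seq_measurable g ->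
  (forall z, 0 <= f z) -> (forall z, 0 <= g z) ->
  iint n (fun z => (f z + g z)%:E) =
  (iint n (fun z => (f z)%:E) + iint n (fun z => (g z)%:E))%E.
Proof.
elim: n f g => [|n IHn] f g mf mg f0 g0 //=.
rewrite -ge0_integralD //; first last.
- exact: measurable_iint_ncons.
- by move=> t _; apply: iint_ge0 => z; rewrite lee_fin.
- exact: measurable_iint_ncons.
- by move=> t _; apply: iint_ge0 => z; rewrite lee_fin.
by apply: eq_integral => t _; apply: IHn => //; exact: seq_measurable_ncons.
Qed.

Lemma iintZl n (c : R) f : 0 <= c -> seq_measurable f -> (forall z, 0 <= f z) ->
  iint n (fun z => (c * f z)%:E) = (c%:E * iint n (fun z => (f z)%:E))%E.
Proof.
move=> c0; elim: n f => [|n IHn] f mf f0 //=.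
rewrite -ge0_integralZl //; first last.
- by move=> t _; apply: iint_ge0 => z; rewrite lee_fin.
- exact: measurable_iint_ncons.
by apply: eq_integral => t _; apply: IHn => //; exact: seq_measurable_ncons.
Qed.

Lemma le_iint n f g : seq_measurable f -> seq_measurable g ->
  (forall z, 0 <= f z) -> (forall z, f z <= g z) ->
  (iint n (fun z => (f z)%:E) <= iint n (fun z => (g z)%:E))%E.
Proof.
elim: n f g => [|n IHn] f g mf mg f0 fg /=; first by rewrite lee_fin.
have g0 z : 0 <= g z by exact: le_trans (fg z).
apply: ge0_le_integral => //.
- by move=> t _; apply: iint_ge0 => z; rewrite lee_fin.
- exact: measurable_iint_ncons.
- exact: measurable_iint_ncons.
- by move=> t _; apply: IHn => //; exact: seq_measurable_ncons.
Qed.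

Lemma seq_measurable_cst (c : R) : seq_measurable (fun=> c).
Proof. by move=> d T z mz. Qed.

Lemma seq_measurable_coord (a : R -> R) i : measurable_fun setT a -> seq_measurable (fun z => a (z i)).
Proof. by move=> ma d T z mz; apply: measurableT_comp. Qed.

Lemma seq_measurableD f g : seq_measurable f -> seq_measurable g -> seq_measurable (fun z => f z + g z).
Proof. by move=> mf mg d T z mz; apply: measurable_funD; [exact: mf|exact: mg]. Qed.

Lemma seq_measurableM f g : seq_measurable f -> seq_measurable g -> seq_measurable (fun z => f z * g z).
Proof. by move=> mf mg d T z mz; apply: measurable_funM; [exact: mf|exact: mg]. Qed.

Lemma seq_measurable_sum (I : Type) (r : seq I) (P : pred I) (F : I -> (nat -> R) -> R) :
  (forall i, seq_measurable (F i)) -> seq_measurable (fun z => \sum_(i <- r | P i) F i z).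
Proof.
move=> mF d T z mz; under eq_fun do rewrite big_mkcond.
elim: r => [|i r IHr]; first by under eq_fun do rewrite big_nil; exact: measurable_cst.
under eq_fun do rewrite big_cons.
by apply: measurable_funD => //; case: (P i) => //; exact: mF.
Qed.

Lemma seq_measurable_prod (I : Type) (r : seq I) (P : pred I) (F : I -> (nat -> R) -> R) :
  (forall i, seq_measurable (F i)) -> seq_measurable (fun z => \prod_(i <- r | P i) F i z).
Proof.
move=> mF d T z mz; under eq_fun do rewrite big_mkcond.
elim: r => [|i r IHr]; first by under eq_fun do rewrite big_nil; exact: measurable_cst.
under eq_fun do rewrite big_cons.
by apply: measurable_funM => //; case: (P i) => //; exact: mF.
Qed.

Lemma iint_sum n (I : Type) (r : seq I) (P : pred I) (F : I -> (nat -> R) -> R) :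
  (forall i, seq_measurable (F i)) -> (forall i z, 0 <= F i z) ->
  iint n (fun z => (\sum_(i <- r | P i) F i z)%:E) =
  (\sum_(i <- r | P i) iint n (fun z => (F i z)%:E))%E.
Proof.
move=> mF F0; elim: r => [|i r IHr].
  rewrite big_nil; under [X in iint n X]eq_fun do rewrite big_nil.
  elim: n => //= n ->; exact: integral0.
rewrite big_cons; under [X in iint n X]eq_fun do rewrite big_cons.
case: (P i) => //; rewrite iintD ?IHr //; first exact: seq_measurable_sum.
by move=> z; apply: sumr_ge0.
Qed.

Lemma iint_mul n (a : R -> R) f : measurable_fun setT a -> (forall t, 0 <= a t) ->
  seq_measurable f -> (forall z, 0 <= f z) ->
  iint n.+1 (fun z => (a (z 0%N) * f (fun i => z i.+1))%:E) =
  (\int[mu]_t (a t)%:E * iint n (fun z => (f z)%:E))%E.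
Proof.
move=> ma a0 mf f0 /=; rewrite -ge0_integralZr //; first last.
- by apply: iint_ge0 => z; rewrite lee_fin.
- by move=> t _; rewrite lee_fin.
- exact/measurable_EFinP.
apply: eq_integral => t _.
by rewrite -iintZl //; congr (iint n _); apply/funext.
Qed.

Lemma iint_prod n (a : R -> R) : measurable_fun setT a -> (forall t, 0 <= a t) ->
  (\int[mu]_t (a t)%:E = 1)%E ->
  iint n (fun z => (\prod_(i < n) a (z i))%:E) = 1%E.
Proof.
move=> ma a0 a1; elim: n => [|n IHn]; first by rewrite /= big_ord0.
under [X in iint _ X]eq_fun do rewrite big_ord_recl.
rewrite (@iint_mul n a (fun z => \prod_(i < n) a (z i))) //.
- by rewrite a1 IHn mule1.
- by apply: seq_measurable_prod => i; exact: seq_measurable_coord.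
- by move=> z; apply: prodr_ge0.
Qed.

(** For independent coordinates of density [a], this is the expectation of a sum: each of the [n]
    terms gives the same single-letter integral, the other factors having mass 1. *)
Lemma iint_prod_sum n (a h : R -> R) : measurable_fun setT a -> (forall t, 0 <= a t) ->
  measurable_fun setT h -> (forall t, 0 <= h t) ->
  (\int[mu]_t (a t)%:E = 1)%E ->
  iint n (fun z => (\prod_(i < n) a (z i) * \sum_(i < n) h (z i))%:E) =
  (n%:R%:E * \int[mu]_t (a t * h t)%:E)%E.
Proof.
move=> ma a0 mh h0 a1.
have mp k : seq_measurable (fun z => \prod_(i < k) a (z i)).
  by apply: seq_measurable_prod => i; exact: seq_measurable_coord.
have p0 k z : 0 <= \prod_(i < k) a (z i) by apply: prodr_ge0.
have ms k : seq_measurable (fun z => \sum_(i < k) h (z i)).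
  by apply: seq_measurable_sum => i; exact: seq_measurable_coord.
have s0 k z : 0 <= \sum_(i < k) h (z i) by apply: sumr_ge0.
have mah : measurable_fun setT (fun t => a t * h t) by exact: measurable_funM.
have ah0 t : 0 <= a t * h t by exact: mulr_ge0.
elim: n => [|n IHn]; first by rewrite /= !big_ord0 mulr0 mul0e.
(* Coordinate 0 is split off both the product and the sum. The first summand yields a new
   single-letter integral, the second the induction hypothesis. *)
have -> : (fun z : nat -> R => (\prod_(i < n.+1) a (z i) * \sum_(i < n.+1) h (z i))%:E) =
  (fun z : nat -> R => ((a (z 0%N) * h (z 0%N)) * \prod_(i < n) a (z i.+1) +
    a (z 0%N) * (\prod_(i < n) a (z i.+1) * \sum_(i < n) h (z i.+1)))%:E).
  apply/funext => z; rewrite !big_ord_recl /=; congr EFin.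
  by rewrite mulrDr mulrAC !mulrA.
have ma' i : seq_measurable (fun z => a (z i)) by exact: seq_measurable_coord.
have mh' i : seq_measurable (fun z => h (z i)) by exact: seq_measurable_coord.
have shift f : seq_measurable f -> seq_measurable (fun z => f (fun i => z i.+1)).
  by move=> mf d T z mz; apply: mf => i; exact: mz.
rewrite iintD.
- rewrite (@iint_mul n (fun t => a t * h t) (fun z => \prod_(i < n) a (z i))) //.
  rewrite (@iint_mul n a (fun z => \prod_(i < n) a (z i) * \sum_(i < n) h (z i))) //.
  + rewrite iint_prod // mule1 a1 mul1e IHn.
    by rewrite -natr1 addrC EFinD ge0_muleDl ?mul1e // lee_fin.
  + exact: seq_measurableM.
  + by move=> z; exact: mulr_ge0.
- apply: seq_measurableM; first exact: seq_measurableM.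
  exact: (shift _ (mp n)).
- apply: seq_measurableM => //.
  by apply: seq_measurableM; [exact: (shift _ (mp n))|exact: (shift _ (ms n))].
- by move=> z; apply: mulr_ge0 => //; exact: (p0 n (fun i => z i.+1)).
- move=> z; apply: mulr_ge0 => //; apply: mulr_ge0.
  + exact: (p0 n (fun i => z i.+1)).
  + exact: (s0 n (fun i => z i.+1)).
Qed.

(** The pushforward of Lebesgue measure under negation is Lebesgue measure itself. *)
Lemma ge0_integralN (f : R -> \bar R) : measurable_fun setT f -> (forall t, 0 <= f t)%E ->
  (\int[mu]_t f (- t)%R = \int[mu]_t f t)%E.
Proof.
move=> mf f0.
transitivity (\int[pushforward mu (-%R : R -> measurableTypeR R)]_t f t)%E.
  by rewrite ge0_integral_pushforward // preimage_setT.
by apply: eq_measure_integral => A mA _; exact: lebesgue_measureN.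
Qed.

Definition flip (b : nat -> bool) (z : nat -> R) : nat -> R :=
  fun i => if b i then - z i else z i.

Lemma seq_measurable_flip b f : seq_measurable f -> seq_measurable (fun z => f (flip b z)).
Proof.
move=> mf d T z mz; apply: mf => i; rewrite /flip; case: (b i) => //.
exact: measurableT_comp.
Qed.

Lemma iint_flip n b f : seq_measurable f -> (forall z, 0 <= f z) ->
  iint n (fun z => (f (flip b z))%:E) = iint n (fun z => (f z)%:E).
Proof.
elim: n b f => [|n IHn] b f mf f0 /=.
  (* [iint 0] evaluates at the zero sequence, which every [flip] fixes. *)
  by congr (f _)%:E; apply/funext => i; rewrite /flip oppr0; case: ifP.
(* The induction hypothesis for the shifted pattern removes the later sign changes; only the
   reflection of the first coordinate remains. *)
transitivity (\int[mu]_t iint n (fun z => (f (ncons (if b 0%N then - t else t) z))%:E))%E.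
  apply: eq_integral => t _.
  rewrite -(IHn (fun i => b i.+1) (fun z => f (ncons _ z))) //.
    congr (iint n _); apply/funext => z; congr (f _)%:E.
    by apply/funext => -[|i]; rewrite /flip /=; case: ifP.
  exact: seq_measurable_ncons.
case: (b 0%N) => //.
apply: (@ge0_integralN (fun t => iint n (fun z => (f (ncons t z))%:E))).
  exact: measurable_iint_ncons.
by move=> t; apply: iint_ge0 => z; rewrite lee_fin.
Qed.

End IteratedIntegral.

(** * The single-letter channel and its equivocation *)

Section Awgn.
Variables (R : realType) (s : R).
Implicit Types (b : 'F_2) (n : nat) (t : R).
Notation mu := (@lebesgue_measure R).

Lemma awgn_g_gt0 b t : 0 < awgn_g s b t.
Proof.
by rewrite mulr_gt0 ?expR_gt0// invr_gt0 sqrtr_gt0 mulr_gt0// pi_gt0.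
Qed.

Lemma awgn_g_ge0 b t : 0 <= awgn_g s b t.
Proof. exact/ltW/awgn_g_gt0. Qed.

Lemma awgn_g_normal b : awgn_g s b = normal_pdf (awgn_mean s b) 1.
Proof.
apply/funext => t; rewrite normal_pdfE ?oner_neq0//.
by rewrite /normal_peak /normal_fun expr1n mul1r /awgn_g mulr_natl.
Qed.

Lemma measurable_awgn_g b : measurable_fun setT (awgn_g s b).
Proof. by rewrite awgn_g_normal; exact: measurable_normal_pdf. Qed.

Lemma integral_awgn_g b : (\int[mu]_t (awgn_g s b t)%:E = 1)%E.
Proof. by rewrite awgn_g_normal integral_normal_pdf. Qed.

Lemma F2_cases b : b = 0 \/ b = 1.
Proof.
by case: b => -[|[|[]]] // i; [left|right]; apply/val_inj.
Qed.

Lemma awgn_meanD b a : awgn_mean s (b + a) = if a == 0 then awgn_mean s b else - awgn_mean s b.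
Proof.
by rewrite /awgn_mean; case: (F2_cases a) (F2_cases b) => -> [] -> //=; rewrite ?opprK.
Qed.

(** The two means are opposite and the Gaussian exponent is even, so flipping the bit amounts to
    reflecting the output. *)
Lemma awgn_gD b a t : awgn_g s (b + a) t = awgn_g s b (if a != 0 then - t else t).
Proof.
rewrite /awgn_g awgn_meanD; case: eqP => //= _.
by rewrite opprK -sqrrN opprD.
Qed.

(** Minus the natural logarithm of the posterior probability of bit 0 given output [t], for a
    uniform input bit. *)
Definition bit_llr t : R := ln ((awgn_g s 0 t + awgn_g s 1 t) / awgn_g s 0 t).

Lemma bit_llr_ge0 t : 0 <= bit_llr t.
Proof.
apply: ln_ge0; rewrite ler_pdivlMr ?awgn_g_gt0// mul1r lerDl.
exact: awgn_g_ge0.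
Qed.

Lemma bit_llrE t : bit_llr t = ln (1 + expR (2 * t * Num.sqrt (2 * s))).
Proof.
have g0 := awgn_g_gt0 0 t; rewrite /bit_llr mulrDl divff ?gt_eqF//; congr (ln (1 + _)).
rewrite /awgn_g invfM invrK mulrACA mulVf ?mul1r; last first.
  by rewrite gt_eqF// sqrtr_gt0 mulr_gt0// pi_gt0.
rewrite -expRN -expRD /awgn_mean eqxx /=; congr expR.
by set m := Num.sqrt _; field.
Qed.

Lemma measurable_bit_llr : measurable_fun setT bit_llr.
Proof.
have -> : bit_llr = (@ln R) \o (fun t => 1 + expR (2 * t * Num.sqrt (2 * s))).
  by apply/funext => t; rewrite bit_llrE.
apply: measurableT_comp => //; apply: measurable_funD => //.
apply: measurableT_comp => //; apply: measurable_funM => //.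
Qed.

(** Since [ln (1 + r) <= r] for the likelihood ratio [r] of bit 1 to bit 0, the integrand is at most
    the density of bit 1, whose mass is 1. *)
Lemma integral_llr_fin : (\int[mu]_t (awgn_g s 0 t * bit_llr t)%:E < +oo)%E.
Proof.
apply: (@le_lt_trans _ _ 1%E); last by rewrite ltry.
rewrite -(integral_awgn_g 1); apply: ge0_le_integral => //.
- by move=> t _; rewrite lee_fin mulr_ge0 ?awgn_g_ge0 ?bit_llr_ge0.
- apply/measurable_EFinP/measurable_funM; first exact: measurable_awgn_g.
  exact: measurable_bit_llr.
- by apply/measurable_EFinP; exact: measurable_awgn_g.
- move=> t _; rewrite lee_fin /bit_llr mulrDl divff ?gt_eqF ?awgn_g_gt0//.
  have r0 : 0 < awgn_g s 1 t / awgn_g s 0 t by rewrite divr_gt0 ?awgn_g_gt0.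
  rewrite mulrC -ler_pdivlMr ?awgn_g_gt0//; apply: le_ln1Dx.
  by rewrite (lt_trans _ r0)// ltrN10.
Qed.

(** The single-letter equivocation in nats. Reflecting [t] and then substituting [t = sqrt 2 * y]
    turns the unit-variance Gaussian into the kernel of the capacity formula. *)
Lemma integral_llr :
  (\int[mu]_t (awgn_g s 0 t * bit_llr t)%:E = (ln 2 * (1 - C_biawgn s))%:E)%E.
Proof.
(* The integrand seen from bit 1, whose mean [sqrt (2 * s)] has the sign that occurs in the capacity
   integral. *)
pose G t : R := awgn_g s 1 t * ln (1 + expR (- (2 * t * Num.sqrt (2 * s)))).
have cid x : {for x, continuous (@id R)} by move=> ?.
have ccst (c : R) x : {for x, continuous (fun _ : R => c)} by exact: cst_continuous.
have cG : continuous G.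
  move=> x.
  have cg : {for x, continuous (awgn_g s 1)}.
    by rewrite awgn_g_normal; apply: continuous_normal_pdf; exact: oner_neq0.
  have cu : {for x, continuous (fun y : R => 1 + expR (- (2 * y * Num.sqrt (2 * s))))}.
    apply: continuousD; first exact: ccst.
    apply: (@continuous_comp _ _ _ (fun y : R => - (2 * y * Num.sqrt (2 * s))) expR); last exact: continuous_expR.
    apply: continuousN; apply: continuousM; last exact: ccst.
    by apply: continuousM; [exact: ccst|exact: cid].
  have cl : {for x, continuous (@ln R \o (fun y : R => 1 + expR (- (2 * y * Num.sqrt (2 * s)))))}.
    by apply: continuous_comp => //; apply: continuous_ln; rewrite ltr_pwDl// expR_ge0.
  exact: continuousM cg cl.
have G0 t : 0 <= G t.
  by rewrite mulr_ge0 ?awgn_g_ge0// ln_ge0// lerDl expR_ge0.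
have GN t : G (- t) = awgn_g s 0 t * bit_llr t.
  rewrite /G bit_llrE -[1 : 'F_2]add0r awgn_gD oner_eq0 /= opprK.
  by rewrite mulrN mulNr opprK.
have sq20 : 0 < Num.sqrt 2 :> R by rewrite sqrtr_gt0.
pose F (y : R) : R := Num.sqrt 2 * y.
have F'E : F^`()%classic = cst (Num.sqrt 2).
  apply/funext => x; rewrite /F derive1E deriveM// derive_cst derive_id.
  by rewrite scaler0 addr0 /GRing.scale /= mulr1.
(* The Jacobian [sqrt 2] reduces [1 / sqrt (2 * pi)] to [1 / sqrt pi], and the factor [ln 2]
   compensates the change from [ln] to [log2]. *)
have pe (y : R) : (((G \o F) * (F^`())%classic)%R y = ((Num.sqrt pi)^-1 * ln 2) *
    (expR (- (y - Num.sqrt s) ^+ 2) * log2 (1 + expR (- (4 * y * Num.sqrt s)))))%R.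
  rewrite F'E /log2 /= /G /awgn_g /F /awgn_mean oner_eq0 /=.
  rewrite !fctE /= !(sqrtrM _ (ler0n _ 2)).
  have sq2 : Num.sqrt 2 ^+ 2 = 2 :> R by rewrite sqr_sqrtr.
  have -> : - (Num.sqrt 2 * y - Num.sqrt 2 * Num.sqrt s) ^+ 2 / 2 = - (y - Num.sqrt s) ^+ 2 :> R.
    by rewrite -mulrBr exprMn sq2; field.
  have -> : 2 * (Num.sqrt 2 * y) * (Num.sqrt 2 * Num.sqrt s) = 4 * y * Num.sqrt s :> R.
    transitivity (2 * (Num.sqrt 2 ^+ 2) * y * Num.sqrt s :> R); first by ring.
    by rewrite sq2; ring.
  have pi0 : Num.sqrt pi != 0 :> R by rewrite gt_eqF// sqrtr_gt0 pi_gt0.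
  have l20 : ln 2 != 0 :> R by rewrite gt_eqF// ln_gt0// ltr1n.
  by field; rewrite l20 pi0 gt_eqF.
have mJ : measurable_fun setT (fun y : R => (expR (- (y - Num.sqrt s) ^+ 2) * log2 (1 + expR (- (4 * y * Num.sqrt s))))%:E).
  apply/measurable_EFinP; apply: measurable_funM.
    apply: measurableT_comp => //; apply: measurableT_comp => //.
    by apply: measurable_funX; exact: measurable_funB.
  apply: measurable_funM => //; apply: measurableT_comp => //.
  apply: measurable_funD => //; apply: measurableT_comp => //.
  by apply: measurableT_comp => //; apply: measurable_funM => //; exact: measurable_funM.
have J0 y : 0 <= expR (- (y - Num.sqrt s) ^+ 2) * log2 (1 + expR (- (4 * y * Num.sqrt s))).
  rewrite mulr_ge0 ?expR_ge0// divr_ge0// ln_ge0//; first by rewrite lerDl expR_ge0.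
  by rewrite ler1n.
have c0 : 0 < (Num.sqrt pi)^-1 * ln 2 :> R.
  by rewrite mulr_gt0 ?ln_gt0 ?ltr1n// invr_gt0 sqrtr_gt0 pi_gt0.
have E : (\int[mu]_t (awgn_g s 0 t * bit_llr t)%:E = ((Num.sqrt pi)^-1 * ln 2)%:E *
   \int[mu]_y (expR (- (y - Num.sqrt s) ^+ 2) * log2 (1 + expR (- (4 * y * Num.sqrt s))))%:E)%E.
  rewrite -ge0_integralZl//; last 2 first.
  - by move=> y _; rewrite lee_fin.
  - by rewrite lee_fin ltW.
  transitivity (\int[mu]_t (G (- t))%:E)%E.
    by apply: eq_integral => t _; rewrite GN.
  rewrite (@ge0_integralN _ (fun t => (G t)%:E)); last 2 first.
  - by apply/measurable_EFinP; exact: continuous_measurable_fun.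
  - by move=> t; rewrite lee_fin.
  rewrite (@increasing_ge0_integration_by_substitutionT _ F)//.
  - by apply: eq_integral => y _; rewrite pe.
  - by move=> x y xy; rewrite /F ltr_pM2l.
  - by rewrite F'E => ?; exact: cvg_cst.
  - by rewrite F'E; exact: is_cvg_cst.
  - by rewrite F'E; exact: is_cvg_cst.
  - by apply/gt0_cvgMrNy.
  - by apply/gt0_cvgMry.
(* [C_biawgn] goes through [fine], which sends an infinite integral to 0, so finiteness is needed
   first; it is transferred along [E] because the constant is positive. *)
have fJ : (\int[mu]_y (expR (- (y - Num.sqrt s) ^+ 2) * log2 (1 + expR (- (4 * y * Num.sqrt s))))%:E)%E \is a fin_num.
  rewrite ge0_fin_numE; last by apply: integral_ge0 => y _; rewrite lee_fin.
  rewrite ltey; apply/eqP => Jy; have := integral_llr_fin.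
  by rewrite E Jy gt0_muley ?lte_fin// ltxx.
rewrite E -(fineK fJ) -EFinM /C_biawgn; congr EFin.
by rewrite subKr mulrCA mulrA.
Qed.

End Awgn.

(** * The memoryless block channel and its sign symmetry *)

Section BlockChannel.
Variables (R : realType) (s : R) (n : nat).
Implicit Types (x a : 'rV['F_2]_n) (z : nat -> R).
Notation mu := (@lebesgue_measure R).

Lemma chan_gt0 x z : 0 < chan s x z.
Proof. by apply: prodr_gt0 => i _; exact: awgn_g_gt0. Qed.

Lemma chan_ge0 x z : 0 <= chan s x z.
Proof. exact/ltW/chan_gt0. Qed.

Lemma seq_measurable_chan x : seq_measurable (chan s x).
Proof.
by apply: seq_measurable_prod => i; apply: seq_measurable_coord; exact: measurable_awgn_g.
Qed.

(** [flip] takes a pattern on all of [nat], so a word is extended by no sign change beyond its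
    length. *)
Definition word_signs a (i : nat) : bool :=
  if insub i is Some o then a ord0 o != 0 else false.

Lemma chanD x a z : chan s (x + a) z = chan s x (flip (word_signs a) z).
Proof.
apply: eq_bigr => i _.
by rewrite mxE awgn_gD /flip /word_signs valK.
Qed.

(** A sign change reduces to the zero word, for which all factors are one and the same density. *)
Lemma iint_chan x : iint n (fun z => (chan s x z)%:E) = 1%E.
Proof.
have -> : (fun z => (chan s x z)%:E) = (fun z => (chan s (0 : 'rV_n) (flip (word_signs x) z))%:E).
  by apply/funext => z; rewrite -chanD add0r.
rewrite (@iint_flip R n _ (chan s (0 : 'rV_n))); last 2 first.
- exact: seq_measurable_chan.
- exact: chan_ge0.
rewrite -(@iint_prod R n (awgn_g s 0)); last 3 first.
- exact: measurable_awgn_g.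
- exact: awgn_g_ge0.
- exact: integral_awgn_g.
by congr (iint n _); apply/funext => z; congr EFin; apply: eq_bigr => i _; rewrite mxE.
Qed.

(** The output density under a uniform input word, multiplied by [2 ^ n]. *)
Definition out_density z : R := \sum_(x : 'rV['F_2]_n) chan s x z.

(** Expanding the product of two-term sums enumerates all choices of bits, that is, all words. *)
Lemma out_density_prod z :
  out_density z = \prod_(i < n) (awgn_g s 0 (z i) + awgn_g s 1 (z i)).
Proof.
transitivity (\prod_(i < n) \sum_(b : 'F_2) awgn_g s b (z i)); last first.
  apply: eq_bigr => i _; rewrite (bigD1 (0 : 'F_2)) //= (bigD1 (1 : 'F_2)) //=.
  rewrite big1 ?addr0 // => b /andP[b0 b1].
  by case: (F2_cases b) b0 b1 => ->; rewrite ?eqxx.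
rewrite bigA_distr_bigA /out_density /=.
rewrite (reindex (fun f : {ffun 'I_n -> 'F_2} => \row_i f i)) /=; last first.
  exists (fun x : 'rV_n => [ffun i => x ord0 i]) => [f _|x _].
    by apply/ffunP => i; rewrite ffunE mxE.
  by apply/rowP => i; rewrite mxE ffunE.
by apply: eq_bigr => f _; apply: eq_bigr => i _; rewrite mxE.
Qed.

Lemma ln_prod (r : seq 'I_n) (F : 'I_n -> R) : (forall i, 0 < F i) ->
  ln (\prod_(i <- r) F i) = \sum_(i <- r) ln (F i).
Proof.
move=> F0; elim: r => [|i r IHr]; first by rewrite !big_nil ln1.
by rewrite !big_cons lnM ?posrE ?IHr// prodr_gt0.
Qed.

(** H(X | Z) in nats, computed at X = 0. Both densities are products, so the logarithm of their
    ratio is a sum of [bit_llr] over the letters. *)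
Lemma iint_chan_llr :
  iint n (fun z => (chan s (0 : 'rV_n) z * ln (out_density z / chan s (0 : 'rV_n) z))%:E) =
  (n%:R * (ln 2 * (1 - C_biawgn s)))%:E.
Proof.
rewrite EFinM -integral_llr -iint_prod_sum; last 5 first.
- exact: measurable_awgn_g.
- exact: awgn_g_ge0.
- exact: measurable_bit_llr.
- exact: bit_llr_ge0.
- exact: integral_awgn_g.
congr (iint n _); apply/funext => z; congr EFin.
have chan0 : chan s (0 : 'rV_n) z = \prod_(i < n) awgn_g s 0 (z i).
  by apply: eq_bigr => i _; rewrite mxE.
rewrite chan0; congr (_ * _).
rewrite out_density_prod -prodf_div ln_prod // => i.
by rewrite divr_gt0 ?addr_gt0 ?awgn_g_gt0.
Qed.

End BlockChannel.

(* Gibbs' inequality against the weights equal to [1] at the (at most one) strict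
   maximizer of [a] and to [1 / #|C|] elsewhere, of total mass at most [2]. *)
Lemma fano_pointwise (R : realType) (T : finType) (C : {set T}) (a : T -> R) :
  (forall c, 0 < a c) ->
  \sum_(c in C) a c * ln ((\sum_(c in C) a c) / a c) <=
  \sum_(c in C) a c + ln #|C|%:R *
    \sum_(c in C) (if [exists c' in C, (c' != c) && (a c <= a c')] then a c else 0).
Proof.
move=> a0; set S := \sum_(c in C) a c.
pose err c := [exists c' in C, (c' != c) && (a c <= a c')].
have [C0|C0] := posnP #|C|.
  move/eqP: C0; rewrite cards_eq0 => /eqP C0.
  by rewrite /S C0 !big_set0 mulr0 addr0.
have M0 : 0 < #|C|%:R :> R by rewrite ltr0n.
pose q c : R := if err c then #|C|%:R^-1 else 1.
have q0 c : 0 < q c by rewrite /q; case: ifP; rewrite ?invr_gt0.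
have SC c : c \in C -> 0 < S.
  by move=> cC; rewrite /S (bigD1 c) //= ltr_pwDl ?sumr_ge0// => i _; exact: ltW.
have term c : c \in C ->
    a c * ln (S / a c) <= (S * q c - a c) + ln #|C|%:R * (if err c then a c else 0).
  move=> cC; have S0 := SC _ cC.
  (* The logarithm splits in two: [ln u <= u - 1] bounds the part with [u = S * q c / a c], and
     [- ln (q c)] costs [ln #|C|] exactly at the error words. *)
  have -> : S / a c = (S * q c / a c) / q c.
    by rewrite mulrAC mulfK// gt_eqF.
  rewrite ln_div ?posrE ?divr_gt0 ?mulr_gt0// mulrBr; apply: lerD.
    have u0 : 0 < S * q c / a c by rewrite divr_gt0 ?mulr_gt0.
    have : ln (S * q c / a c) <= S * q c / a c - 1.
      rewrite -[X in ln X](subrK 1) addrC; apply: le_ln1Dx.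
      by rewrite ltrBDl subrr.
    move=> /(ler_wpM2l (ltW (a0 c))) /le_trans; apply.
    by rewrite mulrBr mulr1 mulrC divfK ?gt_eqF.
  rewrite /q; case: ifP => _; last by rewrite ln1 !mulr0 oppr0.
  by rewrite lnV ?posrE// mulrN opprK mulrC.
apply: (le_trans (ler_sum _ term)).
rewrite big_split /= -mulr_sumr lerD2r sumrB -/S -mulr_sumr.
have /card_gt0P[c1 /SC S0] := C0.
rewrite lerBlDr -[in leRHS](mulr1 S) -mulrDr ler_pM2l//.
have -> : \sum_(c in C) q c = \sum_(c in C | err c) #|C|%:R^-1 + \sum_(c in C | ~~ err c) 1.
  by rewrite (bigID err) /=; congr (_ + _); apply: eq_bigr => c /andP[_]; rewrite /q;
    [move=> ->|move=> /negbTE ->].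
apply: lerD.
  rewrite sumr_const -(mulr_natr #|C|%:R^-1) ler_pdivrMl// mulr1 ler_nat.
  by apply/subset_leq_card/fintype.subsetP => c /andP[].
(* Two distinct words without error would each be strictly likelier than the other, so there is at
   most one. *)
rewrite sumr_const -[leRHS]/1%:R ler_nat; apply/card_le1_eqP => c c' /andP[cC /existsPn ec] /andP[c'C /existsPn ec'].
apply/eqP/negPn/negP => cc'; have := ec c'; have := ec' c.
rewrite cC c'C cc' eq_sym cc' /= -!ltNge => h1 h2.
by have := lt_trans h1 h2; rewrite ltxx.
Qed.

(** * Cosets of a linear code and the equivocation of the message *)

Section Cosets.
Variables (n : nat) (C : {set 'rV['F_2]_n}).
Hypothesis hC : zmod_closed C.
Implicit Types x y : 'rV['F_2]_n.

Definition coset x : {set 'rV['F_2]_n} := [set x + c | c in C].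

Lemma mem_coset x y : (y \in coset x) = (y - x \in C).
Proof.
apply/imsetP/idP => [[c cC ->]|yx]; first by rewrite addrC addKr.
by exists (y - x); rewrite // addrC subrK.
Qed.

Lemma cosetE x y : y \in coset x -> coset y = coset x.
Proof.
have [C0 CB] := hC; rewrite mem_coset => yx; apply/setP => z; rewrite !mem_coset.
have -> : z - x = (z - y) + (y - x) by rewrite addrA subrK.
have CN u : u \in C -> - u \in C by move=> uC; rewrite -sub0r; exact: CB.
apply/idP/idP => [zy|zx]; first by rewrite -[y - x]opprK; apply: CB => //; exact: CN.
by rewrite -(addrK (y - x) (z - y)); exact: CB.
Qed.

Lemma coset_refl x : x \in coset x.
Proof. by rewrite mem_coset subrr; case: hC. Qed.

Lemma card_coset x : #|coset x| = #|C|.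
Proof. by apply: card_imset; exact: addrI. Qed.

Lemma cosets_card w : w \in cosets C -> #|w| = #|C|.
Proof. by case/imsetP => x _ ->; exact: card_coset. Qed.

(** The cosets partition the space: by [cosetE], the only one containing [x] is [coset x]. *)
Lemma sum_cosets (V : nmodType) (F : {set 'rV['F_2]_n} -> 'rV['F_2]_n -> V) :
  \sum_(w in cosets C) \sum_(x in w) F w x = \sum_x F (coset x) x.
Proof.
rewrite (exchange_big_dep predT) //=; apply: eq_bigr => x _.
rewrite (big_pred1 (coset x)) // => w /=; apply/andP/eqP => [[]|->].
  by case/imsetP => y _ -> xy; rewrite [RHS](cosetE xy).
by rewrite coset_refl imset_f.
Qed.

Lemma card_cosets : (#|cosets C| * #|C| = 2 ^ n)%N.
Proof.
rewrite -sum_nat_const.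
have -> : (\sum_(w in cosets C) #|C| = \sum_(w in cosets C) \sum_(x in w) 1)%N.
  by apply: eq_bigr => w /cosets_card; rewrite sum1_card.
rewrite (@sum_cosets nat (fun _ _ => 1%N)) sum1_card card_mx mul1n.
by rewrite card_Fp.
Qed.

Lemma card_code_gt0 : (0 < #|C|)%N.
Proof. by apply/card_gt0P; exists 0; case: hC. Qed.

Variables (R : realType) (s : R).
Implicit Types z : nat -> R.

(** The output density given the message with coset [C], multiplied by [#|C|]. *)
Definition code_density z : R := \sum_(c in C) chan s c z.

Lemma code_density_gt0 z : 0 < code_density z.
Proof.
rewrite /code_density (bigD1 0) /=; last by case: hC.
by rewrite ltr_pwDl ?chan_gt0// sumr_ge0// => c _; exact: chan_ge0.
Qed.

Lemma seq_measurable_code_density : seq_measurable code_density.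
Proof. by apply: seq_measurable_sum => c; exact: seq_measurable_chan. Qed.

Lemma seq_measurable_out_density : seq_measurable (out_density s n).
Proof. by apply: seq_measurable_sum => c; exact: seq_measurable_chan. Qed.

Lemma out_density_ge z : code_density z <= out_density s n z.
Proof.
rewrite /out_density (bigID (mem C)) /= lerDl.
by apply: sumr_ge0 => x _; exact: chan_ge0.
Qed.

Lemma out_density_gt0 z : 0 < out_density s n z.
Proof. exact: lt_le_trans (code_density_gt0 z) (out_density_ge z). Qed.

Lemma code_density_ge c z : c \in C -> chan s c z <= code_density z.
Proof.
move=> cC; rewrite /code_density (bigD1 c) //= lerDl.
by apply: sumr_ge0 => x _; exact: chan_ge0.
Qed.

(** Translation by [x] permutes the words over which the density sums. *)
Lemma out_density_flip x z : out_density s n (flip (word_signs x) z) = out_density s n z.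
Proof.
rewrite /out_density [RHS](reindex_inj (addIr x)) /=.
by apply: eq_bigr => y _; rewrite chanD.
Qed.

(** This makes all messages equivalent for the eavesdropper, up to sign changes of the output. *)
Lemma sum_coset_chan x z :
  \sum_(y in coset x) chan s y z = code_density (flip (word_signs x) z).
Proof.
rewrite big_imset /=; last by move=> c c' _ _; exact: addrI.
by apply: eq_bigr => c _; rewrite addrC chanD.
Qed.

(** A linear code is its own coset by any of its codewords. *)
Lemma code_density_flip c z : c \in C ->
  code_density (flip (word_signs c) z) = code_density z.
Proof.
move=> cC; rewrite -sum_coset_chan (_ : coset c = C) //.
apply/setP => y; rewrite mem_coset; have [C0 CB] := hC.
apply/idP/idP => [yc|yC]; last exact: CB.
have cN : - c \in C by rewrite -sub0r; exact: CB.
by rewrite -(subrK c y) -[c in _ + c]opprK; exact: CB.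
Qed.

(** A uniform coset followed by a uniform word of it gives every word probability [2 ^ - n]. *)
Lemma pWzw w z : w \in cosets C ->
  pW R C * pzw s w z = (2 ^+ n)^-1 * \sum_(x in w) chan s x z.
Proof.
move=> wC; rewrite /pW /pzw mulrA (cosets_card wC) -invfM -natrM.
by rewrite card_cosets natrX.
Qed.

Lemma pzE z : pz s C z = (2 ^+ n)^-1 * out_density s n z.
Proof.
rewrite /pz (eq_bigr (fun w : {set 'rV['F_2]_n} => \sum_(x in w) (2 ^+ n)^-1 * chan s x z)).
  by rewrite (sum_cosets (fun _ x => (2 ^+ n)^-1 * chan s x z)) mulr_sumr.
by move=> w wC; rewrite pWzw // mulr_sumr.
Qed.

(** The integrand of H(W | Z) at X = 0, in nats: the inverse of the ratio is the posterior
    probability of the coset [C]. *)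
Definition coset_llr z : R := chan s (0 : 'rV_n) z * ln (out_density s n z / code_density z).

(** The integrand of H(X | W, Z) at X = 0, in nats: the inverse of the ratio is the posterior
    probability of the zero word within [C]. *)
Definition code_llr z : R := chan s (0 : 'rV_n) z * ln (code_density z / chan s (0 : 'rV_n) z).

Lemma coset_llr_ge0 z : 0 <= coset_llr z.
Proof.
rewrite mulr_ge0 ?chan_ge0// ln_ge0// ler_pdivlMr ?code_density_gt0// mul1r.
exact: out_density_ge.
Qed.

Lemma code_llr_ge0 z : 0 <= code_llr z.
Proof.
rewrite mulr_ge0 ?chan_ge0// ln_ge0// ler_pdivlMr ?chan_gt0// mul1r.
by apply: code_density_ge; case: hC.
Qed.

Lemma seq_measurable_ratio (f g : (nat -> R) -> R) : seq_measurable f -> seq_measurable g ->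
  (forall z, 0 < f z) -> (forall z, 0 < g z) -> seq_measurable (fun z => ln (f z / g z)).
Proof.
move=> mf mg f0 g0 d T z mz.
have -> : (fun t => ln (f (z t) / g (z t))) = (fun t => ln (f (z t)) - ln (g (z t))).
  by apply/funext => t; rewrite ln_div ?posrE.
by apply: measurable_funB; apply: measurableT_comp => //; [exact: mf|exact: mg].
Qed.

Lemma seq_measurable_coset_llr : seq_measurable coset_llr.
Proof.
apply: seq_measurableM; first exact: seq_measurable_chan.
apply: seq_measurable_ratio; [exact: seq_measurable_out_density|
  exact: seq_measurable_code_density|exact: out_density_gt0|exact: code_density_gt0].
Qed.

Lemma seq_measurable_code_llr : seq_measurable code_llr.
Proof.
apply: seq_measurableM; first exact: seq_measurable_chan.
apply: seq_measurable_ratio; [exact: seq_measurable_code_density|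
  exact: seq_measurable_chan|exact: code_density_gt0|exact: chan_gt0].
Qed.

Lemma HWZ_density z :
  \sum_(w in cosets C) pW R C * pzw s w z * log2 (pz s C z / (pW R C * pzw s w z)) =
  \sum_(x : 'rV['F_2]_n) ((2 ^+ n)^-1 / ln 2) * coset_llr (flip (word_signs x) z).
Proof.
have two0 : (2 ^+ n)^-1 != 0 :> R by rewrite invr_eq0 expf_neq0.
(* The weight of a coset is spread over its words, and [2 ^ - n] cancels inside the logarithm. *)
transitivity (\sum_(w in cosets C) \sum_(x in w) (2 ^+ n)^-1 / ln 2 *
    (chan s x z * ln (out_density s n z / \sum_(y in w) chan s y z)) : R).
  apply: eq_bigr => w wC; rewrite pWzw // pzE -mulr_sumr -mulr_suml.
  by rewrite -mulf_div divff // mul1r /log2 [ln _ / _]mulrC mulrACA.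
rewrite (sum_cosets (fun w x => (2 ^+ n)^-1 / ln 2 *
    (chan s x z * ln (out_density s n z / \sum_(y in w) chan s y z)))).
apply: eq_bigr => x _; rewrite /coset_llr sum_coset_chan out_density_flip.
by rewrite -chanD add0r.
Qed.

(** By [iint_flip] all [2 ^ n] words contribute equally, which cancels the uniform weight;
    [(ln 2)^-1] converts nats to bits. *)
Lemma HWZE : HWZ s C = ((ln 2)^-1%:E * iint n (fun z => (coset_llr z)%:E))%E.
Proof.
have l20 : 0 < ln 2 :> R by rewrite ln_gt0// ltr1n.
have c0 : 0 <= (2 ^+ n)^-1 / ln 2 :> R by rewrite divr_ge0 ?invr_ge0 ?exprn_ge0// ltW.
rewrite /HWZ (_ : (fun z => _) = (fun z =>
    (\sum_(x : 'rV['F_2]_n) ((2 ^+ n)^-1 / ln 2) * coset_llr (flip (word_signs x) z))%:E)); last first.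
  by apply/funext => z; rewrite HWZ_density.
rewrite iint_sum; last 2 first.
- move=> x; apply: seq_measurableM; first exact: seq_measurable_cst.
  by apply: seq_measurable_flip; exact: seq_measurable_coset_llr.
- by move=> x z; rewrite mulr_ge0// coset_llr_ge0.
transitivity (\sum_(x : 'rV['F_2]_n) ((2 ^+ n)^-1 / ln 2)%:E * iint n (fun z => (coset_llr z)%:E))%E.
  apply: eq_bigr => x _; rewrite (@iintZl _ _ _ (fun z => coset_llr (flip (word_signs x) z))) //.
  - by rewrite iint_flip //; [exact: seq_measurable_coset_llr|exact: coset_llr_ge0].
  - by apply: seq_measurable_flip; exact: seq_measurable_coset_llr.
  - by move=> z; exact: coset_llr_ge0.
rewrite -ge0_sume_distrl; last by move=> x _; rewrite lee_fin.
rewrite sumEFin sumr_const; congr (_%:E * _)%E.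
have -> : #|{: 'rV['F_2]_n}| = (2 ^ n)%N by rewrite card_mx mul1n card_Fp.
by rewrite -[_ *+ 2 ^ n]mulr_natl natrX mulVKf // expf_neq0.
Qed.

End Cosets.

(** * Fano's bound for the inner code and the chain rule *)

Section Equivocation.
Variables (R : realType) (s : R) (n : nat) (C : {set 'rV['F_2]_n}).
Hypothesis hC : zmod_closed C.

Lemma measurable_exists d (T : measurableType d) (I : finType) (P : I -> T -> bool) :
  (forall i, measurable_fun setT (P i)) ->
  measurable_fun setT (fun t => [exists i, P i t]).
Proof.
move=> mP; rewrite (_ : (fun t => _) = (fun t => \big[orb/false]_(i <- index_enum I) P i t)); last first.
  by apply/funext => t; rewrite big_orE.
elim: (index_enum I) => [|i r IHr].
  by under eq_fun do rewrite big_nil; exact: measurable_cst.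
by under eq_fun do rewrite big_cons; exact: measurable_or.
Qed.

Definition ml_loss (c : 'rV['F_2]_n) (z : nat -> R) : R :=
  if [exists c' in C, (c' != c) && (chan s c z <= chan s c' z)] then chan s c z else 0.

Lemma ml_loss_ge0 c z : 0 <= ml_loss c z.
Proof. by rewrite /ml_loss; case: ifP => // _; exact: chan_ge0. Qed.

Lemma seq_measurable_ml_loss c : seq_measurable (ml_loss c).
Proof.
move=> d T z mz; apply: measurable_fun_ifT => //; last exact: seq_measurable_chan.
apply: measurable_exists => c'; apply: measurable_and => //; apply: measurable_and => //.
by apply: measurable_fun_ler; exact: seq_measurable_chan.
Qed.

Lemma iint_code_density : iint n (fun z => (code_density C s z)%:E) = #|C|%:R%:E.
Proof.
rewrite /code_density iint_sum; last 2 first.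
- by move=> c; exact: seq_measurable_chan.
- by move=> c z; exact: chan_ge0.
under eq_bigr do rewrite iint_chan.
by rewrite sumEFin sumr_const.
Qed.

(** Fano's inequality in nats: [fano_pointwise] is applied to the likelihoods of the codewords,
    integrated over the output and averaged over the code. *)
Lemma iint_code_llr_le :
  (iint n (fun z => (code_llr C s z)%:E) <= 1 + (ln #|C|%:R)%:E * ml_err C s)%E.
Proof.
have M0 : 0 < #|C|%:R :> R by rewrite ltr0n card_code_gt0.
have lM0 : 0 <= ln #|C|%:R :> R by rewrite ln_ge0// ler1n card_code_gt0.
have mllr := seq_measurable_code_llr hC s.
have llr0 := code_llr_ge0 hC s.
(* By the sign symmetry the integral for the zero word equals that for every codeword, so the sum
   over the code is [#|C|] equal terms. *)
have E : (\sum_(c in C) iint n (fun z => (code_llr C s z)%:E) =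
    iint n (fun z => (\sum_(c in C) chan s c z * ln (code_density C s z / chan s c z))%:E))%E.
  rewrite (_ : (fun z => (\sum_(c in C) _)%:E) =
      (fun z => (\sum_(c in C) code_llr C s (flip (word_signs c) z))%:E)); last first.
    apply/funext => z; congr EFin; apply: eq_bigr => c cC.
    by rewrite /code_llr code_density_flip // -chanD add0r.
  rewrite iint_sum; first by apply: eq_bigr => c _; rewrite iint_flip.
  - by move=> c; exact: seq_measurable_flip.
  - by move=> c z; exact: llr0.
have loss0 z : 0 <= ln #|C|%:R * \sum_(c in C) ml_loss c z.
  by rewrite mulr_ge0// sumr_ge0// => c _; exact: ml_loss_ge0.
have mloss : seq_measurable (fun z => \sum_(c in C) ml_loss c z).
  by apply: seq_measurable_sum => c; exact: seq_measurable_ml_loss.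
have F : (iint n (fun z => (\sum_(c in C) chan s c z * ln (code_density C s z / chan s c z))%:E) <=
    iint n (fun z => (code_density C s z + ln #|C|%:R * \sum_(c in C) ml_loss c z)%:E))%E.
  apply: le_iint.
  - rewrite (_ : (fun z => _) = (fun z => \sum_(c in C) code_llr C s (flip (word_signs c) z))).
      by apply: seq_measurable_sum => c; exact: seq_measurable_flip.
    apply/funext => z; apply: eq_bigr => c cC.
    by rewrite /code_llr code_density_flip // -chanD add0r.
  - apply: seq_measurableD; first exact: seq_measurable_code_density.
    by apply: seq_measurableM => //; exact: seq_measurable_cst.
  - move=> z; apply: sumr_ge0 => c cC; rewrite mulr_ge0 ?chan_ge0// ln_ge0//.
    by rewrite ler_pdivlMr ?chan_gt0// mul1r code_density_ge.
  - by move=> z; apply: fano_pointwise => c; exact: chan_gt0.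
move: F; rewrite -E iintD//; last 3 first.
- exact: seq_measurable_code_density.
- by apply: seq_measurableM => //; exact: seq_measurable_cst.
- by move=> z; exact/ltW/code_density_gt0.
rewrite iint_code_density iintZl //; last by move=> z; rewrite sumr_ge0// => c _; exact: ml_loss_ge0.
rewrite iint_sum; last 2 first.
- exact: seq_measurable_ml_loss.
- exact: ml_loss_ge0.
set B := iint n _; set L := (\sum_(c in C) iint n _)%E => F.
have -> : ml_err C s = (#|C|%:R^-1%:E * L)%E by [].
have B0 : (0 <= B)%E by apply: iint_ge0 => z; rewrite lee_fin.
(* Multiplying by [#|C|] cancels the averaging factor in [ml_err] and matches the [#|C|] equal terms
   of [F]. *)
rewrite -(@lee_pmul2l _ #|C|%:R%:E) ?lte_fin//.
rewrite ge0_muleDr ?mule1//; last first.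
  rewrite mule_ge0 ?lee_fin// mule_ge0 ?lee_fin ?invr_ge0 ?(ltW M0)//.
  by apply: sume_ge0 => c _; apply: iint_ge0 => z; rewrite lee_fin ml_loss_ge0.
rewrite muleCA [in X in (_ + _ * X)%E]muleA -EFinM divff ?gt_eqF// mul1e.
apply: le_trans F; rewrite sumr_const.
by rewrite mule_natl.
Qed.

(** The chain rule at X = 0: the two likelihood ratios multiply to that of [iint_chan_llr], so their
    logarithms add up. *)
Lemma iint_llr_chain : (iint n (fun z => (coset_llr C s z)%:E) +
  iint n (fun z => (code_llr C s z)%:E) = (n%:R * (ln 2 * (1 - C_biawgn s)))%:E)%E.
Proof.
rewrite -iint_chan_llr -iintD; last 4 first.
- exact: seq_measurable_coset_llr.
- exact: seq_measurable_code_llr.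
- exact: coset_llr_ge0.
- exact: code_llr_ge0.
congr (iint n _); apply/funext => z; congr EFin.
rewrite /coset_llr /code_llr -mulrDr; congr (_ * _).
rewrite !ln_div ?posrE ?chan_gt0 ?(out_density_gt0 hC) ?(code_density_gt0 hC)//.
by rewrite addrA subrK.
Qed.

End Equivocation.

(** * Code cardinalities, the legitimate receiver and the passage to the limit *)

Lemma code_zmod_closed k n (G : 'M['F_2]_(k, n)) : zmod_closed (code G).
Proof.
split=> [|x y]; rewrite !inE ?sub0mx// => xG yG.
by rewrite addmx_sub// eqmx_opp.
Qed.

Lemma card_code k n (G : 'M['F_2]_(k, n)) : row_free G -> #|code G| = (2 ^ k)%N.
Proof.
move=> fG; have -> : code G = [set v *m G | v : 'rV['F_2]_k].
  apply/setP => x; rewrite inE; apply/submxP/imsetP => [[v ->]|[v _ ->]]; by exists v.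
by rewrite card_imset ?card_mx ?mul1n ?card_Fp//; exact: row_free_inj.
Qed.

(** The received word is the sent one, and each word of a coset determines that coset. *)
Lemma legit_err0 (R : realType) n (C : {set 'rV['F_2]_n}) : zmod_closed C -> legit_err R C = 0.
Proof.
move=> hC; rewrite /legit_err big1 // => _ /imsetP[y _ ->].
rewrite (_ : [set x in _ | _] = finset.set0) ?cards0 ?mulr0//.
apply/setP => x; rewrite !inE; apply/andP => -[xy /negP]; apply.
by apply/eqP; exact: (cosetE hC).
Qed.

Lemma log2_card_cosets (R : realType) k n (G : 'M['F_2]_(k, n)) : row_free G ->
  log2 (#|cosets (code G)|%:R : R) = n%:R - k%:R.
Proof.
move=> fG; have := card_cosets (code_zmod_closed G); rewrite card_code // => E.
have l20 : ln 2 != 0 :> R by rewrite gt_eqF// ln_gt0// ltr1n.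
have q0 : 0 < #|cosets (code G)|%:R :> R.
  rewrite ltr0n lt0n; apply/eqP => q0; move: E; rewrite q0 mul0n => /esym/eqP.
  by rewrite expn_eq0.
have : ln (#|cosets (code G)|%:R * 2 ^+ k : R) = ln (2 ^+ n).
  by rewrite -!natrX -natrM E.
rewrite lnM ?posrE ?exprn_gt0// !lnXn// -!(mulr_natl (ln 2)) => /eqP.
rewrite eq_sym -subr_eq -mulrBl => /eqP H.
by rewrite /log2 -H mulfK.
Qed.

(** The upper bound drops H(X | W, Z), which is nonnegative; the lower bound replaces it by Fano's
    bound, converted to bits. *)
Lemma HWZ_rate_bounds (R : realType) (s : R) k n (G : 'M['F_2]_(k, n)) :
  row_free G -> ml_err (code G) s \is a fin_num ->
  exists2 h : R, HWZ s (code G) = h%:E &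
    n%:R * (1 - C_biawgn s) - ((ln 2)^-1 + k%:R * fine (ml_err (code G) s)) <= h
      <= n%:R * (1 - C_biawgn s).
Proof.
move=> fG /fineK; set e := fine _ => ee.
have hC := code_zmod_closed G.
have l20 : 0 < ln 2 :> R by rewrite ln_gt0// ltr1n.
have := iint_code_llr_le s hC; have := iint_llr_chain s hC; rewrite HWZE// -ee card_code//.
have : (0 <= iint n (fun z => (coset_llr (code G) s z)%:E))%E.
  by apply: iint_ge0 => z; rewrite lee_fin coset_llr_ge0.
have : (0 <= iint n (fun z => (code_llr (code G) s z)%:E))%E.
  by apply: iint_ge0 => z; rewrite lee_fin code_llr_ge0.
(* Two nonnegative extended reals with a finite sum are both real, which leaves a single case. *)
case: (iint n (fun z => (code_llr (code G) s z)%:E)) => [b| |] //;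
case: (iint n (fun z => (coset_llr (code G) s z)%:E)) => [a| |] //.
rewrite natrX lnXn// -EFinM -EFinD -!EFinD !lee_fin => b0 a0 [ab] be.
exists ((ln 2)^-1 * a) => //.
have aE : a = n%:R * (ln 2 * (1 - C_biawgn s)) - b by rewrite -ab addrK.
have haE : (ln 2)^-1 * a = n%:R * (1 - C_biawgn s) - b / ln 2.
  by rewrite aE; field; rewrite gt_eqF.
rewrite haE lerD2l lerN2 gerBl divr_ge0// ?(ltW l20)// andbT.
rewrite ler_pdivrMr// (le_trans be)// mulrDl mulVf ?gt_eqF// lerD2l.
by rewrite -(mulr_natl (ln 2)) -mulrA mulrAC mulrA lexx.
Qed.
Theorem theorem1 (R : realType) (lambda R1 lstar : R)
    (N K : nat -> nat) (G : forall j, 'M['F_2]_(K j, N j)) :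
  0 < lambda ->
  (* code sequence: block lengths N j -> oo, rank-K j generator matrices, rate R1 *)
  (0 < N 0)%N -> (forall j, (N j < N j.+1)%N) ->
  (forall j, row_free (G j)) ->
  (forall j, (K j)%:R = R1 * (N j)%:R) ->
  (* good: nonzero rate, and SNR threshold lstar *)
  0 < R1 ->
  is_snr_threshold G lstar ->
  lstar <= lambda ->
  (* the nested code {C0 = F_2^n, C1 = code (G j)} achieves (1 - R1, 1 - C(lambda)) *)
  (forall j, log2 (#|cosets (code (G j))|%:R : R) = (1 - R1) * (N j)%:R) /\
  ((fun j => legit_err R (code (G j))) @ \oo --> (0 : R))%classic /\
  (exists L : R,
     ((fun j => (HWZ lambda (code (G j)) * ((N j)%:R^-1)%:E)%E) @ \oo --> L%:E)%classic /\
     1 - C_biawgn lambda <= L).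
Proof.
move=> l0 N0 Ninc fG KE R10 [thr _] lle.
(* Strict growth from a positive length gives [N j >= j + 1], so that [1 / N j] is at most
   [harmonic j]. *)
have Npos j : (j < N j)%N.
  by elim: j => [//|j IHj]; exact: leq_ltn_trans IHj (Ninc j).
have NR j : 0 < (N j)%:R :> R by rewrite ltr0n (leq_ltn_trans _ (Npos j)).
split.
  by move=> j; rewrite log2_card_cosets// KE mulrBl mul1r.
split.
  under eq_fun do rewrite (legit_err0 _ (code_zmod_closed _)).
  exact: cvg_cst.
exists (1 - C_biawgn lambda); split => //.
(* The error is extended-real valued: its convergence to 0 gives eventual finiteness and convergence
   of the real parts. *)
have /fine_cvgP[efin ecvg] := thr _ lle.
have l20 : 0 < ln 2 :> R by rewrite ln_gt0// ltr1n.
(* The lower bound of [HWZ_rate_bounds] divided by [N j], with [K j / N j] equal to [R1] and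
   [1 / N j] weakened to [harmonic j]. *)
pose lower j := (1 - C_biawgn lambda) -
  ((ln 2)^-1 * harmonic j + R1 * fine (ml_err (code (G j)) lambda)).
have lcvg : (lower @ \oo --> (1 - C_biawgn lambda))%classic.
  rewrite -[X in (_ --> X)%classic]subr0; apply: cvgB; first exact: cvg_cst.
  rewrite -[X in (_ --> X)%classic]addr0; apply: cvgD.
    rewrite -[X in (_ --> X)%classic](mulr0 (ln 2)^-1).
    by apply: cvgM; [exact: cvg_cst|exact: cvg_harmonic].
  rewrite -[X in (_ --> X)%classic](mulr0 R1).
  by apply: cvgM; [exact: cvg_cst|exact: ecvg].
apply: (@squeeze_cvge _ _ _ _ (fun j => (lower j)%:E) _ (fun=> (1 - C_biawgn lambda)%:E)).
- near=> j.
  have ej : ml_err (code (G j)) lambda \is a fin_num by near: j.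
  have [h -> /andP[h1 h2]] := HWZ_rate_bounds (fG j) ej.
  rewrite -EFinM !lee_fin; apply/andP; split; last first.
    by rewrite ler_pdivrMr// mulrC.
  rewrite ler_pdivlMr//; apply: le_trans h1; rewrite /lower KE.
  rewrite mulrBl [(1 - _) * _]mulrC lerD2l lerN2 mulrDl lerD//; last by rewrite mulrAC.
  rewrite -mulrA -[leLHS]mulr1 ler_pM2l ?invr_gt0// /harmonic /=.
  by rewrite mulrC ler_pdivlMr// mul1r ler_nat.
- by apply: cvg_EFin; [exact: nearW|exact: lcvg].
- exact: cvg_cst.
Unshelve. all: by end_near.
Qed.
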